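(* Let $A=[a_0,\ldots,a_{\ell-1}]$ and $B=[b_0,\ldots,b_{\ell-1}]$ form a quaternary Legendre pair $(A,B)$ of even length $\ell$ with $\sum_{j=0}^{\ell-1}a_j=0$ and $\sum_{j=0}^{\ell-1}b_j=1+i$. 1. For $\ell\equiv 0\bmod 2$, $PSD(B_2,1)$ is an integer with $$PSD(B_2,1)\equiv 2\bmod 8,$$ and the square-free parts of both $$PSD(B_2,1)\quad\mbox{and}\quad PSD(A_2,1)=2\ell+2-PSD(B_2,1)$$ are not divisible by a prime $\equiv 3\bmod 4$. 2. For $\ell\equiv 0\bmod 4$, $PSD(B_4,1)$ is an integer with $$PSD(B_4,1)\equiv 2\bmod 8,$$ and the square-free parts of both $$PSD(B_4,1)\quad\mbox{and}\quad PSD(A_4,1)=2\ell+2-PSD(B_4,1)$$ are not divisible by a prime $\equiv 3\bmod 4$.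
   Context: Here $i=\sqrt{-1}$. A finite complex sequence $A=[a_0,\ldots,a_{\ell-1}]$ of length $\ell$ is continued periodically with period $\ell$. Its periodic autocorrelation function is $PAF(A,s)=\sum_{j=0}^{\ell-1}a_j\overline{a_{j+s}}$, its discrete Fourier transform is $DFT(A,s)=\sum_{j=0}^{\ell-1}a_j\xi_\ell^{js}$ with $\xi_\ell=\exp(2\pi i/\ell)$, and its power spectral density is $PSD(A,s)=|DFT(A,s)|^2$ ($\ell$ being the length of the sequence in question). Two sequences $A,B$ of length $\ell$ form a Legendre pair $(A,B)$ if $PAF(A,s)+PAF(B,s)=-2$ for $s=1,2,\ldots,\lfloor\ell/2\rfloor$ (equivalently for $s=1,\ldots,\ell-1$). It is quaternary if $A,B\in\{-1,1,-i,i\}^\ell$. For a divisor $k$ of $\ell$, $A_k=[a_0^{(k)},\ldots,a_{k-1}^{(k)}]$ denotes the $\frac{\ell}{k}$-compression of $A$, the sequence of length $k$ given by $a_j^{(k)}=\sum_{n=0}^{\ell/k-1}a_{kn+j}$, $j=0,\ldots,k-1$; $B_k$ is defined likewise from $B$. Thus $PSD(A_k,1)$ is computed with length $k$ and $\xi_k=\exp(2\pi i/k)$. The square-free part of a positive integer $n$ is the unique square-free positive integer $d$ with $n=dm^2$ for some integer $m$. The value $PSD(A_k,1)=0$ can occur; in that case the condition on the square-free part of $PSD(A_k,1)$ is regarded as vacuous. *)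

(* Defs.v *)
From HB Require Import structures.
From mathcomp Require Import all_boot all_order all_algebra.
From mathcomp Require Import zify.
From mathcomp Require Import reals trigo.
From mathcomp Require Export complex.

Set Implicit Arguments.
Unset Strict Implicit.
Unset Printing Implicit Defensive.

Import Order.TTheory GRing.Theory Num.Theory.
Local Open Scope ring_scope.
Local Open Scope complex_scope.

Definition expi {R : realType} (x : R) : R[i] := cos x +i* sin x.

Definition xi (R : realType) (l : nat) : R[i] := expi (2 * pi / l%:R).

(* A finite sequence is a [seq], so that its length is [size A]; its periodic
   continuation is [fun j => A`_(j %% size A)]. *)
Definition PAF {R : realType} (A : seq R[i]) (s : nat) : R[i] :=
  \sum_(j < size A) A`_j * (A`_((j + s) %% size A))^*.

Definition DFT {R : realType} (A : seq R[i]) (s : nat) : R[i] :=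
  \sum_(j < size A) A`_j * xi R (size A) ^+ (j * s).

(* [`|_|] is the norm of the complex field, hence takes its values in [R[i]]. *)
Definition PSD {R : realType} (A : seq R[i]) (s : nat) : R[i] :=
  `|DFT A s| ^+ 2.

(* [compression k A] has length [k]; it is meant for [k %| size A]. *)
Definition compression {R : realType} (k : nat) (A : seq R[i]) : seq R[i] :=
  mkseq (fun j => \sum_(n < size A %/ k) A`_(k * n + j)) k.

Definition legendre_pair {R : realType} {l : nat} (A B : l.-tuple R[i]) : Prop :=
  forall s : nat, (1 <= s <= l %/ 2)%N -> PAF A s + PAF B s = - 2.

Definition quaternary {R : realType} (A : seq R[i]) : Prop :=
  {subset A <= [:: -1; 1; - 'i%C; 'i%C]}.

Definition quaternary_legendre_pair {R : realType} {l : nat}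
    (A B : l.-tuple R[i]) : Prop :=
  [/\ quaternary A, quaternary B & legendre_pair A B].

Definition squarefree (d : nat) : Prop :=
  forall m : nat, (m ^ 2 %| d)%N -> m = 1%N.

(* No [d] is a square-free part of [0]: conditions quantified over the
   square-free part are then vacuous. *)
Definition is_squarefree_part (n d : nat) : Prop :=
  [/\ (0 < n)%N, squarefree d & exists m : nat, n = (d * m ^ 2)%N].

Lemma squarefree_part_exists_unique (n : nat) :
  (0 < n)%N -> exists! d, is_squarefree_part n d.
Proof.
move=> n0.
have ex : exists d, is_squarefree_part n d.
  elim/ltn_ind: n n0 => n IH n0.
  have [/hasP[m]|/hasPn H] :=
    boolP (has (fun m => (1 < m) && (m ^ 2 %| n))%N (iota 0 n.+1)).
    move=> _ /andP[m1 /dvdnP[q qE]].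
    have q0 : (0 < q)%N by case: q qE n0 => // ->.
    have [|//|d [_ sd [k kE]]] := IH q.
      by rewrite qE ltn_Pmulr // -[1%N](exp1n 2) ltn_exp2r.
    exists d; split=> //; exists (k * m)%N.
    by rewrite qE kE expnMn mulnA.
  exists n; split=> //; last by exists 1%N; rewrite exp1n muln1.
  move=> m mn.
  have le : (m ^ 2 <= n)%N by apply: dvdn_leq.
  have m0 : (0 < m)%N by case: m mn {le} => //; rewrite exp0n // dvd0n; lia.
  have /H : m \in iota 0 n.+1 by rewrite mem_iota; nia.
  by rewrite mn andbT; lia.
case: ex => d hd; exists d; split=> // d'.
case: hd => _ sd [m dE] [_ sd' [m' d'E]].
have val e p : squarefree e -> prime p -> (logn p e <= 1)%N.
  move=> se pp; rewrite leqNgt; apply/negP => lt.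
  have : (p ^ 2 %| e)%N by apply: dvdn_trans (pfactor_dvdnn p e); apply: dvdn_exp2l.
  by move/se => p1; rewrite p1 in pp.
have [d0 m0] : ((0 < d) /\ (0 < m))%N by rewrite dE in n0; nia.
have [d0' m0'] : ((0 < d') /\ (0 < m'))%N by rewrite d'E in n0; nia.
apply: eqn_from_log => // p.
case pp: (prime p); last by rewrite /logn pp.
have := congr1 (logn p) (etrans (esym dE) d'E).
rewrite !expnS !expn0 !muln1 !lognM ?muln_gt0 ?m0 ?m0' //.
have := val _ _ sd pp; have := val _ _ sd' pp; lia.
Qed.

(* Main.v *)
Require Import Defs.
From mathcomp Require Import all_boot all_order all_algebra.
From mathcomp Require finfield.
From mathcomp Require Import reals trigo zify ring.

(** Let [zeta] be [xi R k], which is [-1] for [k = 2] and ['i] for [k = 4]; in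
    both cases [zeta] is a Gaussian integer.  Since [zeta ^+ k = 1], the Fourier
    coefficient of the compression equals the sum of the [A`_j * zeta ^+ j] over
    the whole sequence.

    Expanding its squared norm gives a finite Wiener-Khinchin formula: the
    squared norm is the Fourier transform of the periodic autocorrelation
    ([sqr_norm_PAF]).  For a quaternary Legendre pair the two autocorrelations
    add up to [2l] at shift [0] and to [-2] at every other shift, and the powers
    of a nontrivial root of unity sum to [0], so the two squared norms add up to
    [2l + 2] ([legendre_pair_norm]).

    The Fourier coefficients are Gaussian integers, so the power spectral
    densities are sums of two squares, in which a prime [p = 3 %[mod 4]] occurs
    to an even power because [-1] is not a square modulo [p]
    ([even_logn_sum_sqr]); hence it does not divide the square-free part
    ([squarefree_part_sum_sqr]).

    It remains to see that [DFT (compression k B) 1] has odd real and imaginary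
    parts, as then both squares are [1] modulo [8].  For [k = 2] the coefficient
    differs from the sum [1 + i] of [B] by twice a Gaussian integer.  For
    [k = 4], let [E] be the sum of the entries of even index and [O] that of the
    entries of odd index, so [E + O = 1 + i].  Modulo [2] the coefficient is
    [E + i * O = (1 - i) * E + i - 1].  Now [E] is a sum of [l / 2] units, each
    congruent to [1] modulo [1 + i], and [l / 2] is even: thus [1 + i] divides
    [E], so [2] divides [(1 - i) * E], and both parts are odd
    ([DFT_compression4]). *)

Import Order.TTheory GRing.Theory Num.Theory.
Local Open Scope ring_scope.
Local Open Scope complex_scope.

(** * Sums of two squares and primes congruent to 3 modulo 4 *)

(** If [p] did not divide [x], then [-1] would be a square modulo [p]; raising
    [x ^ 2 = - y ^ 2] to the odd power [(p - 1) / 2] turns both squares into [1]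
    by Fermat's little theorem, leaving [1 = -1] modulo [p]. *)
Lemma prime3mod4_dvd_sum_sqr (p x y : nat) :
  prime p -> p = 3 %[mod 4] -> (p %| x ^ 2 + y ^ 2)%N -> (p %| x)%N.
Proof.
move=> p_pr p3 pxy; apply/negP => /negP px.
have p_char := pchar_Fp p_pr.
have py : ~~ (p %| y)%N.
  apply: contra px => py; have := pxy.
  by rewrite dvdn_addl Euclid_dvdX ?py // andbT.
(* The exponent [(p - 1) / 2 = 2 q + 1] is odd. *)
have [q qE] : exists q, p = (q.*2.+1.*2.+1)%N.
  by exists (p %/ 4)%N; move: p3; rewrite [in RHS]modn_small //; lia.
have little a : ~~ (p %| a)%N -> (a%:R : 'F_p) ^+ q.*2.+1.*2 = 1.
  rewrite (dvdn_pcharf p_char) => a0; apply: (mulfI a0).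
  by rewrite -exprS -qE mulr1 -{2}[a%:R]finfield.expf_card card_Fp.
have : (x%:R : 'F_p) ^+ 2 = - y%:R ^+ 2.
  by apply/eqP; rewrite -addr_eq0 -!natrX -natrD -(dvdn_pcharf p_char).
move/(congr1 (fun z => z ^+ q.*2.+1)).
rewrite -exprM mul2n little // exprNn -exprM mul2n little // mulr1.
rewrite -signr_odd /= odd_double expr1 => /eqP.
rewrite -addr_eq0 -mulr2n -(dvdn_pcharf p_char) => /dvdn_leq.
by lia.
Qed.

(** Descent: if [p] divides the sum, it divides both [x] and [y], and removing
    the common factor [p ^ 2] lowers the valuation by [2].  The case
    [x = y = 0] is covered by the convention [logn p 0 = 0]. *)
Lemma even_logn_sum_sqr (p x y : nat) :
  prime p -> p = 3 %[mod 4] -> ~~ odd (logn p (x ^ 2 + y ^ 2)).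
Proof.
move=> p_pr p3; have [n] := ubnP (x + y)%N.
elim: n x y => // n IH x y le_n.
have [/eqP|nz] := eqVneq (x + y)%N 0%N.
  by rewrite addn_eq0 => /andP[/eqP-> /eqP->]; rewrite logn0.
have [pxy|] := boolP (p %| x ^ 2 + y ^ 2)%N; last first.
  by move=> npxy; rewrite lognE (negbTE npxy) !andbF.
have /dvdnP[v yE] : (p %| y)%N.
  by apply: (@prime3mod4_dvd_sum_sqr p y x); rewrite // addnC.
have /dvdnP[u xE] : (p %| x)%N by exact: prime3mod4_dvd_sum_sqr pxy.
have p_gt1 := prime_gt1 p_pr.
have uvE : (x + y = (u + v) * p)%N by rewrite xE yE mulnDl.
have uv0 : (0 < u + v)%N by move: nz; rewrite uvE muln_eq0; case: (u + v)%N.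
have uv2_gt0 : (0 < u ^ 2 + v ^ 2)%N.
  by rewrite addn_gt0 !expn_gt0 !orbF -addn_gt0.
have p2_gt0 : (0 < p ^ 2)%N by rewrite expn_gt0 prime_gt0.
rewrite xE yE !expnMn -mulnDl lognM //.
rewrite lognX oddD oddM /= addbF; apply: IH.
by apply: leq_trans (_ : (u + v < x + y)%N) _; rewrite // uvE ltn_Pmulr.
Qed.

Lemma squarefree_part_sum_sqr (x y d p : nat) :
  is_squarefree_part (x ^ 2 + y ^ 2) d -> prime p -> p = 3 %[mod 4] ->
  ~ (p %| d)%N.
Proof.
move=> [n_gt0 sqf_d [m nE]] p_pr p3 pd.
have := @even_logn_sum_sqr p x y p_pr p3.
rewrite nE in n_gt0 *; move: n_gt0; rewrite muln_gt0 => /andP[d_gt0 m2_gt0].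
rewrite lognM // lognX oddD oddM /= addbF.
suff -> : logn p d = 1%N by [].
apply/eqP; rewrite eqn_leq -{2}(expn1 p) -pfactor_dvdn // expn1 pd andbT leqNgt.
apply/negP => lt1; have /sqf_d p1 : (p ^ 2 %| d)%N by rewrite pfactor_dvdn.
by rewrite p1 in p_pr.
Qed.

(** * Gaussian integers *)

Definition gint {R : realType} (x y : int) : R[i] := x%:~R +i* y%:~R.

Lemma gintD (R : realType) (x y u v : int) :
  gint x y + gint u v = gint (x + u) (y + v) :> R[i].
Proof. by rewrite /gint !rmorphD. Qed.

Lemma gintN (R : realType) (x y : int) :
  - gint x y = gint (- x) (- y) :> R[i].
Proof. by rewrite /gint !rmorphN. Qed.

Lemma gintM (R : realType) (x y u v : int) :
  gint x y * gint u v = gint (x * u - y * v) (x * v + y * u) :> R[i].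
Proof. by rewrite /gint rmorphB !rmorphD !rmorphM. Qed.

Lemma gint_inj (R : realType) (x y u v : int) :
  gint x y = gint u v :> R[i] -> x = u /\ y = v.
Proof. by case=> /intr_inj -> /intr_inj ->. Qed.

Lemma sqr_norm_gint (R : realType) (x y : int) :
  `|gint x y : R[i]| ^+ 2 = (`|x| ^ 2 + `|y| ^ 2)%N%:R.
Proof.
rewrite -add_Re2_Im2 /= natrD !natrX.
have sqr_abs (t : int) : (t%:~R : R) ^+ 2 = `|t|%N%:R ^+ 2.
  by rewrite natr_absz intr_norm real_normK ?num_real.
by rewrite !sqr_abs rmorphD !rmorphXn !rmorph_nat.
Qed.

(** * Compressions of quaternary sequences *)

(** Each of the four units is congruent to [1] modulo [1 + i], and
    [x + i y] is congruent to [x + y] modulo [1 + i]. *)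
Lemma quaternary_sum (R : realType) (n : nat) (F : 'I_n -> R[i]) :
  (forall j, F j \in [:: -1; 1; - 'i%C; 'i%C]) ->
  exists x y t : int, \sum_(j < n) F j = gint x y /\ x + y = n%:Z + t * 2.
Proof.
elim: n F => [|n IH] F qF.
  by exists 0, 0, 0; rewrite big_ord0.
have [|x [y [t [sE xyE]]]] := IH (fun j => F (widen_ord (leqnSn n) j)) => //.
rewrite big_ord_recr /= sE; move: (qF ord_max).
have i1 : 1 = gint 1 0 :> R[i] by [].
have ii : 'i%C = gint 0 1 :> R[i] by [].
rewrite i1 ii !gintN !inE => /or4P[] /eqP->; rewrite gintD.
- by exists (x - 1), y, (t - 1); split; [congr gint|]; lia.
- by exists (x + 1), y, t; split; [congr gint|]; lia.
- by exists x, (y - 1), (t - 1); split; [congr gint|]; lia.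
- by exists x, (y + 1), t; split; [congr gint|]; lia.
Qed.

Lemma nth_compression (R : realType) (k j : nat) (A : seq R[i]) : (j < k)%N ->
  (compression k A)`_j = \sum_(n < size A %/ k) A`_(k * n + j).
Proof. by move=> jk; rewrite nth_mkseq. Qed.

Lemma quaternary_compression {R : realType} (k j : nat) {A : seq R[i]} :
  (k %| size A)%N -> (j < k)%N -> quaternary A ->
  exists x y t : int, (compression k A)`_j = gint x y /\
    x + y = (size A %/ k)%N%:Z + t * 2.
Proof.
move=> kA jk qA; rewrite nth_compression //; apply: quaternary_sum => n.
apply/qA/mem_nth/(@leq_trans (k * n.+1)%N).
  by rewrite mulnS addnC ltn_add2r.
by rewrite mulnC -leq_divRL // (leq_trans _ jk).
Qed.

(** The compression groups the indices by their residue modulo [k], and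
    [z ^+ j] depends only on that residue. *)
Lemma sum_compression (R : realType) (k : nat) (A : seq R[i]) (z : R[i]) :
  (k %| size A)%N -> z ^+ k = 1 ->
  \sum_(j < k) (compression k A)`_j * z ^+ j = \sum_(j < size A) A`_j * z ^+ j.
Proof.
move=> kA zk.
transitivity
  (\sum_(j < k) \sum_(n < size A %/ k) A`_(k * n + j) * z ^+ (k * n + j)).
  apply: eq_bigr => j _; rewrite nth_compression // big_distrl /=.
  by apply: eq_bigr => n _; rewrite exprD exprM zk expr1n mul1r.
rewrite exchange_big -(big_mkord xpredT (fun j => A`_j * z ^+ j)).
rewrite -[in RHS](divnK kA) big_nat_mul big_mkord; apply: eq_bigr => n _.
rewrite -{1}[(n * k)%N]add0n big_addn mulSn addnK big_mkord.
by apply: eq_bigr => j _; rewrite [(j + _)%N]addnC mulnC.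
Qed.

Lemma sum_compression1 {R : realType} {k : nat} {A : seq R[i]} :
  (k %| size A)%N ->
  \sum_(j < k) (compression k A)`_j = \sum_(j < size A) A`_j.
Proof.
move=> kA; have := @sum_compression R k A 1 kA (expr1n _ _).
by under eq_bigr do rewrite expr1n mulr1;
   under [in RHS]eq_bigr do rewrite expr1n mulr1.
Qed.

(** * Power spectral density of a Legendre pair *)

(** A finite Wiener-Khinchin formula: as [z^* = z^-1], the product of the terms
    of indices [j] and [j + s] in the expanded square is [z^* ^+ s] times a term
    of [PAF A s]. *)
Lemma sqr_norm_PAF (R : realType) (A : seq R[i]) (z : R[i]) :
  z ^+ size A = 1 ->
  `|\sum_(j < size A) A`_j * z ^+ j| ^+ 2
    = \sum_(s < size A) PAF A s * z^*%R ^+ s.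
Proof.
have [->|] := posnP (size A); first by rewrite !big_ord0 normr0 expr0n.
rewrite /PAF; case: (size A) => // n _ zn.
have z1 : z * z^*%R = 1.
  have : `|z| == 1 by rewrite -(@pexpr_eq1 _ _ n.+1) // -normrX zn normr1.
  by rewrite -normCK => /eqP->; rewrite expr1n.
have zcn : z^*%R ^+ n.+1 = 1 by rewrite -rmorphXn zn rmorph1.
rewrite normCK rmorph_sum big_distrl /=.
under [RHS]eq_bigr do rewrite big_distrl /=.
rewrite [RHS]exchange_big; apply: eq_bigr => j _ /=.
rewrite big_distrr (reindex_inj (addrI j)) /=.
apply: eq_bigr => s _; rewrite rmorphM rmorphXn /= (expr_mod _ zcn) exprD.
transitivity
  (A`_j * (A`_((j + s) %% n.+1))^*%R * (z * z^*%R) ^+ j * z^*%R ^+ s).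
  by rewrite exprMn; ring.
by rewrite z1 expr1n mulr1.
Qed.

(** The definition of a Legendre pair prescribes the shifts up to [l / 2]; this
    symmetry carries the prescription over to the larger ones. *)
Lemma PAF_opp (R : realType) (A : seq R[i]) (s : nat) : (s <= size A)%N ->
  PAF A (size A - s) = (PAF A s)^*%R.
Proof.
rewrite /PAF; case: (size A) => [|n] sn; first by rewrite !big_ord0 rmorph0.
rewrite rmorph_sum [LHS](reindex_inj (addrI (inZp s))) /=.
apply: eq_bigr => j _; rewrite rmorphM /= conjCK mulrC.
rewrite !modnDml -addnA modnDml addnCA subnKC // (addnC s j).
by rewrite modnDr modn_small.
Qed.

Lemma PAF0_quaternary (R : realType) (A : seq R[i]) : quaternary A ->
  PAF A 0 = (size A)%:R.
Proof.
move=> qA; rewrite /PAF (eq_bigr (fun=> 1)) ?sumr_const ?card_ord // => j _.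
rewrite addn0 modn_small // -normCK.
have /qA : A`_j \in A by apply: mem_nth.
have ni : `|'i%C : R[i]| = 1.
  by rewrite normc_def /= expr0n expr1n add0r sqrtr1.
by rewrite !inE => /or4P[] /eqP->; rewrite ?normrN ?normr1 ?ni expr1n.
Qed.

Lemma legendre_pair_PAF {R : realType} {l : nat} {A B : l.-tuple R[i]} :
  legendre_pair A B -> forall s : nat, (0 < s < l)%N ->
  PAF A s + PAF B s = - 2.
Proof.
move=> AB s /andP[s0 sl].
have [le|lt] := leqP s (l %/ 2); first by apply: AB; rewrite s0.
have PAFE (C : l.-tuple R[i]) : PAF C s = (PAF C (l - s))^*%R.
  by rewrite -PAF_opp size_tuple ?leq_subr // subKn // ltnW.
rewrite !PAFE -rmorphD AB ?rmorphN ?rmorph_nat //; lia.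
Qed.

(** The shift [0] contributes [l] for each sequence; every other shift [s]
    contributes [-2 * z^* ^+ s], and these powers of [z^*] sum to [-1]. *)
Lemma legendre_pair_norm {R : realType} {l : nat} {A B : l.-tuple R[i]}
    (z : R[i]) :
  quaternary_legendre_pair A B -> (0 < l)%N -> z ^+ l = 1 -> z != 1 ->
  `|\sum_(j < l) A`_j * z ^+ j| ^+ 2 + `|\sum_(j < l) B`_j * z ^+ j| ^+ 2
    = (2 * l + 2)%:R.
Proof.
move=> [qA qB AB] l_gt0 zl z1.
have := @sqr_norm_PAF R A z; have := @sqr_norm_PAF R B z.
rewrite !size_tuple => /(_ zl)-> /(_ zl)->; rewrite -big_split /=.
have geo : \sum_(s < l) z^*%R ^+ s = 0.
  have z1' : z^*%R - 1 != 0.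
    by rewrite subr_eq0 -(inj_eq (can_inj (@conjCK _))) conjCK rmorph1.
  by apply: (mulfI z1'); rewrite -subrX1 -rmorphXn zl rmorph1 subrr mulr0.
pose i0 := Ordinal l_gt0.
move: geo; rewrite (bigD1 i0) //= expr0 => /eqP.
rewrite addrC addr_eq0 => /eqP geo.
rewrite (bigD1 i0) //= !PAF0_quaternary // !size_tuple expr0.
rewrite (eq_bigr (fun s : 'I_l => - 2 * z^*%R ^+ s)); last first.
  move=> s s0; rewrite -mulrDl (legendre_pair_PAF AB) // ltn_ord andbT lt0n.
  exact: s0.
by rewrite -big_distrr /= geo natrD natrM; ring.
Qed.

Lemma legendre_pair_PSD_compression {R : realType} {l : nat} (k : nat)
    {A B : l.-tuple R[i]} :
  quaternary_legendre_pair A B -> (0 < l)%N -> (k %| l)%N ->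
  xi R k ^+ k = 1 -> xi R k != 1 ->
  PSD (compression k A) 1 + PSD (compression k B) 1 = (2 * l + 2)%:R.
Proof.
move=> AB l_gt0 kl xik xi1.
have xil : xi R k ^+ l = 1 by rewrite -(divnK kl) mulnC exprM xik expr1n.
have DFTE (C : l.-tuple R[i]) :
    DFT (compression k C) 1 = \sum_(j < l) C`_j * xi R k ^+ j.
  have := @sum_compression R k C (xi R k); rewrite size_tuple => <- //.
  by rewrite /DFT size_mkseq; under eq_bigr do rewrite muln1.
by rewrite /PSD !DFTE (legendre_pair_norm _ AB).
Qed.

(** * Parity of the Fourier coefficients *)

Lemma xi2 (R : realType) : xi R 2 = -1.
Proof.
rewrite /xi /expi mulrAC divff ?pnatr_eq0 // mul1r cospi sinpi.
by congr Complex; rewrite oppr0.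
Qed.

Lemma xi4 (R : realType) : xi R 4 = 'i%C.
Proof.
rewrite /xi /expi; have -> : 2 * pi / 4 = pi / 2 :> R by field.
by rewrite cos_pihalf sin_pihalf.
Qed.

Lemma DFT_compression2 {R : realType} {A : seq R[i]} {p q : int} :
  (2 %| size A)%N -> quaternary A -> \sum_(j < size A) A`_j = gint p q ->
  exists s t : int, DFT (compression 2 A) 1 = gint (p + s * 2) (q + t * 2).
Proof.
move=> dA qA; rewrite -(sum_compression1 dA) /DFT size_mkseq xi2.
have [x0 [y0 [t0 [c0 _]]]] := quaternary_compression 2 0 dA isT qA.
have [x1 [y1 [t1 [c1 _]]]] := quaternary_compression 2 1 dA isT qA.
move: (compression 2 A) c0 c1 => c c0 c1.
rewrite !big_ord_recl !big_ord0 /bump /= c0 c1.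
rewrite muln1 expr0 expr1 mulr1 mulrN1 !addr0 gintN !gintD => /gint_inj[<- <-].
by exists (- x1), (- y1); congr gint; ring.
Qed.

(** The exchange of [p] and [q] comes from the factor [i] of the entries of odd
    index.  The two compressed entries of even index are both congruent to
    [size A / 4] modulo [1 + i], so that [1 + i] divides their sum: this is what
    makes the remaining error a multiple of [2], not only of [1 + i]. *)
Lemma DFT_compression4 {R : realType} {A : seq R[i]} {p q : int} :
  (4 %| size A)%N -> quaternary A -> \sum_(j < size A) A`_j = gint p q ->
  exists s t : int, DFT (compression 4 A) 1 = gint (q + s * 2) (p + t * 2).
Proof.
move=> dA qA; rewrite -(sum_compression1 dA) /DFT size_mkseq xi4.
have [x0 [y0 [t0 [c0 e0]]]] := quaternary_compression 4 0 dA isT qA.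
have [x1 [y1 [t1 [c1 _]]]] := quaternary_compression 4 1 dA isT qA.
have [x2 [y2 [t2 [c2 e2]]]] := quaternary_compression 4 2 dA isT qA.
have [x3 [y3 [t3 [c3 _]]]] := quaternary_compression 4 3 dA isT qA.
have -> : 'i%C = gint 0 1 :> R[i] by [].
move: (compression 4 A) c0 c1 c2 c3 => c c0 c1 c2 c3.
rewrite !big_ord_recl !big_ord0 /bump /= c0 c1 c2 c3.
rewrite !exprS expr0 !mulr1 !addr0 !gintM !gintD => /gint_inj[pE qE].
by exists (t0 - t2 - y0 - y1), (t0 - t2 - x0 - x3); congr gint; lia.
Qed.

(** [(2 m + 1) ^ 2 = 4 m (m + 1) + 1], and [m (m + 1)] is even. *)
Lemma sqr_odd_mod8 (x : int) : (`|(1 + x * 2)%R| ^ 2 = 1 %[mod 8])%N.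
Proof.
have [m ->] : exists m : nat, `|(1 + x * 2)%R|%N = (m.*2.+1)%N.
  by exists (`|(1 + x * 2)%R|%N./2); lia.
have [t tE] : exists t, (m * m.+1 = t.*2)%N.
  by exists (m * m.+1)./2; rewrite even_halfK // oddM /= andbN.
have -> : (m.*2.+1 ^ 2 = t * 8 + 1)%N by nia.
by rewrite modnMDl.
Qed.

(** The conclusion common to the two values of [k]: all that depends on [k] is
    that the coefficients are Gaussian integers, with odd real and imaginary
    parts in the case of [B]. *)
Lemma PSD_compression_odd_gint (R : realType) (l k : nat) (A B : l.-tuple R[i])
    (x y u v : int) :
  (0 < l)%N -> (k %| l)%N -> xi R k ^+ k = 1 -> xi R k != 1 ->
  quaternary_legendre_pair A B ->
  DFT (compression k A) 1 = gint u v ->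
  DFT (compression k B) 1 = gint (1 + x * 2) (1 + y * 2) ->
    exists b a : nat,
      [/\ PSD (compression k B) 1 = b%:R /\ b = 2 %[mod 8],
          PSD (compression k A) 1 = a%:R /\
            PSD (compression k A) 1 = (2 * l + 2)%:R - PSD (compression k B) 1,
          forall d p : nat, is_squarefree_part b d ->
            prime p -> p = 3 %[mod 4] -> ~ (p %| d)%N
        & forall d p : nat, is_squarefree_part a d ->
            prime p -> p = 3 %[mod 4] -> ~ (p %| d)%N].
Proof.
move=> l_gt0 kl xik xi1 AB DA DB.
exists (`|(1 + x * 2)%R| ^ 2 + `|(1 + y * 2)%R| ^ 2)%N, (`|u| ^ 2 + `|v| ^ 2)%N.
split; [split| split| exact: squarefree_part_sum_sqr..].
- by rewrite /PSD DB sqr_norm_gint.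
- by rewrite -modnDm !sqr_odd_mod8.
- by rewrite /PSD DA sqr_norm_gint.
- by rewrite -(legendre_pair_PSD_compression k AB) // addrK.
Qed.

Theorem theorem3 (R : realType) (l : nat) (A B : l.-tuple R[i])
    (l_even : (2 %| l)%N)
    (AB : quaternary_legendre_pair A B)
    (sumA : \sum_(j < l) A`_j = 0)
    (sumB : \sum_(j < l) B`_j = 1 + 'i%C) :
  ((2 %| l)%N ->
    exists b a : nat,
      [/\ PSD (compression 2 B) 1 = b%:R /\ b = 2 %[mod 8],
          PSD (compression 2 A) 1 = a%:R /\
            PSD (compression 2 A) 1 = (2 * l + 2)%:R - PSD (compression 2 B) 1,
          forall d p : nat, is_squarefree_part b d ->
            prime p -> p = 3 %[mod 4] -> ~ (p %| d)%N
        & forall d p : nat, is_squarefree_part a d ->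
            prime p -> p = 3 %[mod 4] -> ~ (p %| d)%N])
  /\
  ((4 %| l)%N ->
    exists b a : nat,
      [/\ PSD (compression 4 B) 1 = b%:R /\ b = 2 %[mod 8],
          PSD (compression 4 A) 1 = a%:R /\
            PSD (compression 4 A) 1 = (2 * l + 2)%:R - PSD (compression 4 B) 1,
          forall d p : nat, is_squarefree_part b d ->
            prime p -> p = 3 %[mod 4] -> ~ (p %| d)%N
        & forall d p : nat, is_squarefree_part a d ->
            prime p -> p = 3 %[mod 4] -> ~ (p %| d)%N]).
Proof.
have qA : quaternary A by case: AB.
have qB : quaternary B by case: AB.
have sA : \sum_(j < size A) A`_j = gint 0 0 by rewrite size_tuple.
have sB : \sum_(j < size B) B`_j = gint 1 1.
  by rewrite size_tuple sumB; congr Complex; rewrite ?addr0 ?add0r.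
have l_gt0 : (0 < l)%N.
  have [sz0|] := posnP (size B); last by rewrite size_tuple.
  by move: sB; rewrite sz0 big_ord0 => -[] /eqP; rewrite eq_sym oner_eq0.
split=> [l2|l4].
  have := DFT_compression2 _ qA sA; rewrite size_tuple => /(_ l2)[u [v DA]].
  have := DFT_compression2 _ qB sB; rewrite size_tuple => /(_ l2)[x [y DB]].
  apply: (PSD_compression_odd_gint _ _ _ _ _ x y _ _ l_gt0 l2 _ _ AB DA DB).
    by rewrite xi2 sqrrN expr1n.
  by rewrite xi2 eq_sym -subr_eq0 opprK -mulr2n pnatr_eq0.
have := DFT_compression4 _ qA sA; rewrite size_tuple => /(_ l4)[u [v DA]].
have := DFT_compression4 _ qB sB; rewrite size_tuple => /(_ l4)[x [y DB]].
apply: (PSD_compression_odd_gint _ _ _ _ _ x y _ _ l_gt0 l4 _ _ AB DA DB).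
  by rewrite xi4 (exprM _ 2 2) sqr_i sqrrN expr1n.
by rewrite xi4 eq_complex /= oner_eq0 andbF.
Qed.
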